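(* Let $\ell\geqslant 4$ be an integer and let $p=(\ell-3)r+e$ and $q=(\ell-3)s+f$ with integers $r,s\geqslant 0$, $2\leqslant e\leqslant \ell-2$ and $2\leqslant f\leqslant \ell-2$. If $r<s$, then $$ex(p,q,K_{3,\ell})=(\ell-1)(p-2)+2q.$$
   Context: All graphs are simple. An ordered bipartite graph $(G;A,B)$ is a bipartite graph $G$ whose vertex set is partitioned into independent sets $A$ and $B$, each equipped with a linear order. Two vertices $u<v$ of the same part are consecutive if no vertex $w$ of that part satisfies $u<w<v$. Identifying two consecutive vertices $u,v$ replaces them by a single vertex $w$ (in their place in the order) whose neighbourhood is the union of the neighbourhoods of $u$ and $v$. Two ordered bipartite graphs are isomorphic if there is a graph isomorphism between them that maps parts to parts (possibly exchanging the two parts) and preserves both linear orders. An ordered bipartite graph $H$ is an interval minor of $G$ if a graph isomorphic to $H$ can be obtained from $G$ by repeatedly deleting edges and identifying consecutive vertices; otherwise $G$ is $H$-interval minor free. $ex(p,q,H)$ denotes the maximum number of edges of an ordered bipartite graph with parts of sizes $p$ and $q$ (first part of size $p$, second of size $q$) that is $H$-interval minor free; $K_{3,\ell}$ is the complete bipartite graph with parts of sizes $3$ and $\ell$. *)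

(* Defs.v *)
From Stdlib Require Import Relation_Operators.
From mathcomp Require Import all_boot.
From mathcomp Require Import boolp.

Set Implicit Arguments.
Unset Strict Implicit.
Unset Printing Implicit Defensive.

(* Finite linear orders are represented by ordinals: the parts A and B are
   'I_m and 'I_n with their usual order, and (a, b) \in edges G means that
   a in A and b in B are adjacent.  Graphs are thus simple and bipartite by
   construction. *)
Record obgraph := OBGraph {
  lsize : nat;
  rsize : nat;
  edges : {set 'I_lsize * 'I_rsize} }.

Definition swap (G : obgraph) : obgraph :=
  OBGraph [set x : 'I_(rsize G) * 'I_(lsize G) | (x.2, x.1) \in edges G].

Definition consecutive n (u v : 'I_n) : Prop :=
  u < v /\ ~ exists w : 'I_n, u < w /\ w < v.

(* When v is the vertex following u, the map unbump u sends every k <= u to k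
   and every k > u to k.-1: it merges u and v into one vertex (numbered u),
   keeps all other vertices distinct and respects the order. *)
Definition identl m n (E : {set 'I_m.+1 * 'I_n}) (u : 'I_m.+1) :
    {set 'I_m * 'I_n} :=
  [set x : 'I_m * 'I_n | [exists y in E, (unbump u y.1 == x.1) && (y.2 == x.2)]].

Definition identr m n (E : {set 'I_m * 'I_n.+1}) (u : 'I_n.+1) :
    {set 'I_m * 'I_n} :=
  [set x : 'I_m * 'I_n | [exists y in E, (y.1 == x.1) && (unbump u y.2 == x.2)]].

Inductive minor_step : obgraph -> obgraph -> Prop :=
| DeleteEdge m n (E : {set 'I_m * 'I_n}) x :
    x \in E -> minor_step (OBGraph E) (OBGraph (E :\ x))
| IdentifyL m n (E : {set 'I_m.+1 * 'I_n}) (u v : 'I_m.+1) :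
    consecutive u v -> minor_step (OBGraph E) (OBGraph (identl E u))
| IdentifyR m n (E : {set 'I_m * 'I_n.+1}) (u v : 'I_n.+1) :
    consecutive u v -> minor_step (OBGraph E) (OBGraph (identr E u)).

Definition ordered_iso (G H : obgraph) : Prop :=
  exists (f : 'I_(lsize G) -> 'I_(lsize H)) (g : 'I_(rsize G) -> 'I_(rsize H)),
    [/\ bijective f, bijective g,
        forall i j, (f i <= f j) = (i <= j),
        forall i j, (g i <= g j) = (i <= j)
      & forall a b, ((f a, g b) \in edges H) = ((a, b) \in edges G)].

Definition isomorphic (G H : obgraph) : Prop :=
  ordered_iso G H \/ ordered_iso (swap G) H.

Definition interval_minor (H G : obgraph) : Prop :=
  exists2 K, clos_refl_trans obgraph minor_step G K & isomorphic K H.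

(* The maximum is over a nonempty family as soon as H has an edge; on an empty
   family \max is 0. *)
Definition ex_interval (p q : nat) (H : obgraph) : nat :=
  \max_(E : {set 'I_p * 'I_q} | `[< ~ interval_minor H (OBGraph E) >]) #|E|.

Definition complete_bipartite (m n : nat) : obgraph :=
  OBGraph [set: 'I_m * 'I_n].

(* Main.v *)
(** View edge sets as 0-1 matrices.  [K_(a, b)] is an interval minor of [G] iff
    rows and columns can be cut into [a] and [b] intervals with every block
    nonzero, up to exchanging the two sides.

    Upper bound: delete the topmost and the bottommost entry of each column (at
    most [2 q] entries).  If a row kept [l] entries, then that row, the rows
    above it and the rows below it would give a [K_(3, l)].  So each row other
    than the first and last keeps at most [l - 1] entries.

    Lower bound: with [k = l - 3], overlap full [(k + 2) x (k + 2)] blocks along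
    a diagonal in [2 x 2] corners, filling up the last two rows.  Row [i] is the
    interval [[L i, R i]] with [R (i - 1) - L (i + 1) = k + 1], so the rows above
    and the rows below a given row share a range of only [k + 2 = l - 1]
    columns, and likewise for columns; the band fits in [q] columns because
    [r < s]. *)

Require Import Defs.
From mathcomp Require Import all_boot.
From mathcomp Require Import boolp zify.
From Stdlib Require Import Relation_Operators.

Set Implicit Arguments.
Unset Strict Implicit.
Unset Printing Implicit Defensive.

(** * Interval minors as pairs of monotone maps *)

(* [folds G K]: monotone maps of the parts under which every edge of [K] is the
   image of an edge of [G]; for complete [K] this is the block condition. *)
Definition folds (G K : obgraph) : Prop :=
  exists (f : 'I_(lsize G) -> 'I_(lsize K)) (g : 'I_(rsize G) -> 'I_(rsize K)),
    [/\ forall x y : 'I__, x <= y -> f x <= f y,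
        forall x y : 'I__, x <= y -> g x <= g y
      & forall z, z \in edges K ->
          exists2 x, x \in edges G & z = (f x.1, g x.2)].

Lemma folds_refl G : folds G G.
Proof. by exists id, id; split=> // -[a b] Hz; exists (a, b). Qed.

Lemma folds_trans H G K : folds G H -> folds H K -> folds G K.
Proof.
move=> [f [g [mf mg Hfg]]] [f' [g' [mf' mg' Hfg']]].
exists (f' \o f), (g' \o g); split=> [x y le_xy|x y le_xy|z].
- exact/mf'/mf.
- exact/mg'/mg.
- by case/Hfg'=> y /Hfg[x Ex ->] ->; exists x.
Qed.

Lemma folds_swap G K : folds G K -> folds (swap G) (swap K).
Proof.
move=> [f [g [mf mg Hfg]]]; exists g, f; split=> // -[a b].
by rewrite inE => /Hfg[[x y] Exy [-> ->]]; exists (y, x); rewrite ?inE.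
Qed.

Lemma ltn_unbump m (u : nat) (x : 'I_m.+1) : u < m -> unbump u x < m.
Proof. by rewrite /unbump; case: x => x /= ltx; lia. Qed.

Lemma minor_step_folds G K : minor_step G K -> folds G K.
Proof.
case=> {G K} [m n E x0 _ | m n E u v [lt_uv _] | m n E u v [lt_uv _]].
- by exists id, id; split=> // -[a b]; rewrite /= !inE => /andP[_ Eab]; exists (a, b).
- have lt_um : u < m by have := ltn_ord v; lia.
  exists (fun x => Ordinal (ltn_unbump x lt_um)), id; split=> //.
    by move=> x y /=; rewrite /unbump; lia.
  move=> [a b]; rewrite /= inE => /exists_inP[[x y] Exy /= /andP[/eqP Dx /eqP Dy]].
  by exists (x, y) => //=; rewrite Dy; congr pair; apply: val_inj.
- have lt_un : u < n by have := ltn_ord v; lia.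
  exists id, (fun x => Ordinal (ltn_unbump x lt_un)); split=> //.
    by move=> x y /=; rewrite /unbump; lia.
  move=> [a b]; rewrite /= inE => /exists_inP[[x y] Exy /= /andP[/eqP Dx /eqP Dy]].
  by exists (x, y) => //=; rewrite Dx; congr pair; apply: val_inj.
Qed.

Lemma ordered_iso_folds G K : ordered_iso G K -> folds G K.
Proof.
move=> [f [g [[f' fK f'K] [g' gK g'K] mf mg Hfg]]].
exists f, g; split=> [x y|x y|[a b] Eab]; rewrite ?mf ?mg //.
by exists (f' a, g' b); rewrite /= ?f'K ?g'K // -Hfg f'K g'K.
Qed.

Lemma interval_minor_folds H G :
  interval_minor H G -> folds G H \/ folds (swap G) H.
Proof.
move=> [K GK isoKH].
have fGK: folds G K.
  elim: GK => [? ? /minor_step_folds | ? | ? ? ? _ IH1 _ IH2] //.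
    exact: folds_refl.
  exact: folds_trans IH1 IH2.
case: isoKH => /ordered_iso_folds; [left | right].
  exact: folds_trans fGK _.
exact: folds_trans (folds_swap fGK) _.
Qed.

(** A monotone map is constant between two points with the same value, so a collision already occurs
    between neighbours, which an identification can merge. *)
Lemma monotone_collision m a (f : 'I_m -> 'I_a) :
    (forall x y : 'I_m, x <= y -> f x <= f y) -> ~ injective f ->
  exists u v : 'I_m, v = u.+1 :> nat /\ f u = f v.
Proof.
move=> mf /injectiveP/injectivePn[x [y neq_xy eq_f]].
wlog lt_xy : x y neq_xy eq_f / x < y.
  move=> IH; case: (ltngtP x y) => [|lt_yx|/val_inj eq_xy]; first exact: IH.
    by apply: (IH y x) => //; rewrite eq_sym.
  by rewrite eq_xy eqxx in neq_xy.
have lt_xm : x.+1 < m by have := ltn_ord y; lia.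
exists x, (Ordinal lt_xm); split=> //; apply/val_inj/eqP.
by rewrite eqn_leq mf //= [f x]eq_f mf.
Qed.

(** [lift v] picks preimages under [unbump u], so composing with it transports [f] to the graph
    where [u] and [v] are merged. *)
Lemma lift_unbump m a (f : 'I_m.+1 -> 'I_a) (u v : 'I_m.+1)
    (x : 'I_m.+1) (y : 'I_m) :
  v = u.+1 :> nat -> f u = f v -> unbump u x = y -> f (lift v y) = f x.
Proof.
move=> Dv fuv Dy; case: (x =P v) Dy => [-> Dy|neq_xv Dy].
  rewrite -fuv; congr f; apply: val_inj; rewrite /= -Dy /bump /unbump; lia.
congr f; apply: val_inj => /=; rewrite /bump -Dy /unbump.
suff: x <> v :> nat by lia.
by move/val_inj.
Qed.

Lemma consecutive_succ n (u v : 'I_n) : v = u.+1 :> nat -> consecutive u v.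
Proof. by move=> Dv; split; [lia | case=> w; lia]. Qed.

Lemma lift_homo m (v : 'I_m.+1) (x y : 'I_m) : x <= y -> lift v x <= lift v y.
Proof. by rewrite /= /bump; lia. Qed.

(** Induction on [m + n]: merge neighbours with equal image while [f] or [g] is not injective; once
    both are, the graph itself is complete. *)
Lemma folds_complete_minor a b m n (E : {set 'I_m * 'I_n}) :
    0 < a -> 0 < b ->
    folds (OBGraph E) (complete_bipartite a b) ->
  interval_minor (complete_bipartite a b) (OBGraph E).
Proof.
move=> a_gt0 b_gt0.
have [N] := ubnP (m + n); elim: N m n E => // N IH m n E ltN.
move=> [f [g [/= mf mg Hfg]]].
have [inj_f | /(monotone_collision mf)[u [v [Dv fuv]]]] := EM (injective f).
  have [inj_g | /(monotone_collision mg)[u [v [Dv guv]]]] := EM (injective g).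
    (* Any row class [c] pairs with the column class 0, which exists by [b_gt0]; the edge over that
       pair shows that [f] is onto. *)
    have Dm: m = a.
      apply/eqP; rewrite eqn_leq; have:= leq_card f inj_f; rewrite !card_ord => ->.
      rewrite -[a]card_ord -[m]card_ord -(card_codom inj_f); apply/subset_leq_card.
      apply/subsetP=> c _; have [|[x y] _ [-> _]] := Hfg (c, Ordinal b_gt0).
        by rewrite inE.
      exact: codom_f.
    have Dn: n = b.
      apply/eqP; rewrite eqn_leq; have:= leq_card g inj_g; rewrite !card_ord => ->.
      rewrite -[b]card_ord -[n]card_ord -(card_codom inj_g); apply/subset_leq_card.
      apply/subsetP=> c _; have [|[x y] _ [_ ->]] := Hfg (Ordinal a_gt0, c).
        by rewrite inE.
      exact: codom_f.
    subst m n; exists (OBGraph E); first exact: rt_refl.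
    left; exists id, id; split=> //; try by exists id.
    move=> x y; have [|[x' y'] Exy' [/inj_f-> /inj_g->]] := Hfg (f x, g y).
      by rewrite inE.
    by rewrite inE Exy'.
  case: n E ltN f g mf mg Hfg inj_f u v Dv guv => [|n] E ltN f g mf mg Hfg inj_f u v Dv guv.
    by have := ltn_ord u.
  have [] := IH m n (identr E u); first by lia.
    exists f, (g \o lift v); split=> //= [x y le_xy|z Hz].
      exact/mg/lift_homo.
    have [[x y] Exy ->] := Hfg _ Hz.
    have lt_un : u < n by have := ltn_ord v; lia.
    exists (x, Ordinal (ltn_unbump y lt_un)).
      by rewrite inE; apply/exists_inP; exists (x, y) => //=; rewrite !eqxx.
    by rewrite /= (lift_unbump (x := y) Dv guv).
  move=> K EK isoK; exists K => //; apply: rt_trans EK; apply: rt_step.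
  exact/IdentifyR/consecutive_succ/Dv.
case: m E ltN f g mf mg Hfg u v Dv fuv => [|m] E ltN f g mf mg Hfg u v Dv fuv.
  by have := ltn_ord u.
have [] := IH m n (identl E u); first by lia.
  exists (f \o lift v), g; split=> //= [x y le_xy|z Hz].
    exact/mf/lift_homo.
  have [[x y] Exy ->] := Hfg _ Hz.
  have lt_um : u < m by have := ltn_ord v; lia.
  exists (Ordinal (ltn_unbump x lt_um), y).
    by rewrite inE; apply/exists_inP; exists (x, y) => //=; rewrite !eqxx.
  by rewrite /= (lift_unbump (x := x) Dv fuv).
move=> K EK isoK; exists K => //; apply: rt_trans EK; apply: rt_step.
exact/IdentifyL/consecutive_succ/Dv.
Qed.

(** * Criteria for excluding and for finding [K_(3, l)] *)

(* Choose a row [i] sent to the middle row of [K_(3, l)].  Every column class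
   meets both the rows above [i], hence columns [< lo + l - 1], and the rows
   below [i], hence columns [>= lo]: [l] classes do not fit. *)
Lemma band_not_folds l m n (E : {set 'I_m * 'I_n}) :
    1 < l ->
    (forall i : nat, 0 < i -> i.+1 < m -> exists lo,
       forall x, x \in E -> (x.1 < i -> x.2 < lo + l.-1) /\ (i < x.1 -> lo <= x.2)) ->
  ~ folds (OBGraph E) (complete_bipartite 3 l).
Proof.
move=> l_gt1 band [f [g [/= mf mg Hfg]]].
have l_gt0 := ltnW l_gt1.
have hit c k (lt_c3 : c < 3) (lt_kl : k < l) :
    exists2 x, x \in E & f x.1 = c :> nat /\ g x.2 = k :> nat.
  by have [|x Ex [Dc Dk]] := Hfg (Ordinal lt_c3, Ordinal lt_kl);
     rewrite ?inE //; exists x; rewrite // -Dc -Dk.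
have flt x y : f x < f y -> x < y.
  by rewrite !ltnNge; apply: contra => /mf.
have glt x y : g x < g y -> x < y.
  by rewrite !ltnNge; apply: contra => /mg.
have [x0 Ex0 [f0 _]] := hit 0 0 isT l_gt0.
have [x1 Ex1 [f1 _]] := hit 1 0 isT l_gt0.
have [x2 Ex2 [f2 _]] := hit 2 0 isT l_gt0.
have lt01 : x0.1 < x1.1 by apply: flt; rewrite f0 f1.
have lt12 : x1.1 < x2.1 by apply: flt; rewrite f1 f2.
have [||lo Hlo] := band x1.1; [by lia | by have := ltn_ord x2.1; lia |].
(* Each new column class costs at least one column, counting from [lo] along the entries of row
   class 2. *)
have right k : k < l -> exists2 y, g y = k :> nat & lo + k <= y.
  elim: k => [|k IHk] lt_kl.
    have [x Ex [fx gx]] := hit 2 0 isT l_gt0; exists x.2 => //.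
    by rewrite addn0; apply: (Hlo _ Ex).2; apply: flt; rewrite f1 fx.
  have [y gy le_y] := IHk (ltnW lt_kl).
  have [x Ex [fx gx]] := hit 2 k.+1 isT lt_kl; exists x.2 => //.
  by rewrite addnS (leq_ltn_trans le_y) // glt // gy gx.
have lt_l1 : l.-1 < l by lia.
have [x Ex [fx gx]] := hit 0 l.-1 isT lt_l1.
have : x.2 < lo + l.-1 by apply: (Hlo _ Ex).1; apply: flt; rewrite f1 fx.
(* Class [l - 2] reaches column [lo + l - 2], so class [l - 1] has no column left before
   [lo + l - 1]. *)
have [|y gy le_y] := right l.-2; first by lia.
suff: y < x.2 by lia.
by apply: glt; rewrite gy gx; lia.
Qed.

(** Discrete intermediate values; applied to a counting function, it locates the element of given
    rank. *)
Lemma ltn_iter_step (h : nat -> nat) t n :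
    h 0 = 0 -> (forall y, h y.+1 <= (h y).+1) -> t < h n ->
  exists y, [/\ y < n, h y = t & h y.+1 = t.+1].
Proof.
move=> h0 hS; elim: n => [|n IHn]; first by rewrite h0.
move=> lt_t; case: (ltnP t (h n)) => [/IHn[y [lt_yn hy hyS]]|le_nt].
  by exists y; split=> //; lia.
by have := hS n; exists n; split=> //; lia.
Qed.

(* If every entry of [A] has an edge above and an edge below row [i], then [l]
   entries separate the columns into [l] classes, each meeting the rows above
   [i], row [i] and the rows below [i]. *)
Lemma rich_row_folds l m n (E : {set 'I_m * 'I_n}) (i : 'I_m) (A : {set 'I_n}) :
    0 < l -> l <= #|A| ->
    (forall j, j \in A -> [/\ (i, j) \in E, exists2 i0 : 'I_m, i0 < i & (i0, j) \in E
                          & exists2 i1 : 'I_m, i < i1 & (i1, j) \in E]) ->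
  folds (OBGraph E) (complete_bipartite 3 l).
Proof.
move=> l_gt0 le_lA HA.
pose rank (y : nat) := #|[set j in A | j < y]|.
have rank0 : rank 0 = 0 by apply: eq_card0 => j; rewrite !inE andbF.
have rankS y : rank y.+1 <= (rank y).+1.
  case: (ltnP y n) => [lt_yn|le_ny].
    apply: (@leq_trans #|Ordinal lt_yn |: [set j in A | j < y]|).
      apply/subset_leq_card/subsetP=> j; rewrite !inE -val_eqE /= ltnS leq_eqVlt.
      by case/andP=> -> /orP[->|->]; rewrite ?orbT.
    by rewrite cardsU1 -[(rank y).+1]add1n leq_add2r leq_b1.
  apply/leqW/subset_leq_card/subsetP=> j; rewrite !inE => /andP[-> _].
  exact: leq_trans le_ny.
have rankn : l <= rank n.
  rewrite (leq_trans le_lA) //; apply/subset_leq_card/subsetP=> j Aj.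
  by rewrite inE Aj ltn_ord.
have rank_mono x y : x <= y -> rank x <= rank y.
  move=> le_xy; apply/subset_leq_card/subsetP=> j; rewrite !inE => /andP[->].
  by move/leq_trans->.
have ltg y : minn l.-1 (rank y) < l by lia.
(* As a sum of booleans, this is 0, 1 or 2 for rows above, at or below [i]. *)
have ltf (x : 'I_m) : (i <= x) + (i < x) < 3 by lia.
exists (fun x => Ordinal (ltf x)), (fun y => Ordinal (ltg y)).
split=> /= [x y le_xy|x y /rank_mono|[c t] _]; try lia.
have [|y [lt_yn ry ryS]] := @ltn_iter_step rank t n rank0 rankS.
  by rewrite (leq_trans (ltn_ord t)).
(* The rank increases on passing [y], which only a column of [A] can cause. *)
have Ay : Ordinal lt_yn \in A.
  apply: contra_eqT ryS => Ay; rewrite -ry neq_ltn -[rank y]addn0; apply/orP; left.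
  rewrite addn0 ltnS; apply/subset_leq_card/subsetP=> j; rewrite !inE ltnS leq_eqVlt.
  case/andP=> Aj; rewrite Aj => /orP[/eqP Dj|//]; case/negP: Ay.
  by rewrite (_ : Ordinal _ = j) //; apply: val_inj.
have Dt : t = Ordinal (ltg y) by apply: val_inj; rewrite /= ry; have := ltn_ord t; lia.
have [Ei [i0 lt_i0 E0] [i1 lt_i1 E1]] := HA _ Ay.
have: [\/ c = 0 :> nat, c = 1 :> nat | c = 2 :> nat].
  by case: c => [[|[|[]]]] //= _; [constructor 1|constructor 2|constructor 3].
by case=> Dc; [exists (i0, Ordinal lt_yn) | exists (i, Ordinal lt_yn)
  | exists (i1, Ordinal lt_yn)] => //=; congr pair => //; apply: val_inj;
  rewrite /= Dc; lia.
Qed.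

(** * Counting edges for the upper bound *)

Lemma card_rows m n (E : {set 'I_m * 'I_n}) :
  #|E| = \sum_i #|[set j | (i, j) \in E]|.
Proof.
rewrite -sum1_card; under [RHS]eq_bigr do rewrite -sum1_card.
by rewrite pair_big_dep /=; apply: eq_bigl => -[i j]; rewrite !inE.
Qed.

Lemma card_not_folds l m n (E : {set 'I_m * 'I_n}) :
    0 < l -> ~ folds (OBGraph E) (complete_bipartite 3 l) ->
  #|E| <= l.-1 * (m - 2) + 2 * n.
Proof.
move=> l_gt0 nE.
pose up (x : 'I_m * 'I_n) := [exists i0 : 'I_m, (i0 < x.1) && ((i0, x.2) \in E)].
pose dn (x : 'I_m * 'I_n) := [exists i1 : 'I_m, (x.1 < i1) && ((i1, x.2) \in E)].
(* With at most one selected entry per column, [snd] is injective on the selection. *)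
have extreme (P : pred ('I_m * 'I_n)) :
    (forall x y, x \in E -> y \in E -> P x -> P y -> x.2 = y.2 -> x.1 = y.1) ->
    #|[set x in E | P x]| <= n.
  move=> injP; rewrite -(card_in_imset (f := snd)).
    by rewrite (leq_trans (max_card _)) ?card_ord.
  move=> [a b] [c d]; rewrite !inE => /andP[E1 P1] /andP[E2 P2] /= eq_bd.
  by have := injP _ _ E1 E2 P1 P2 eq_bd; rewrite /= eq_bd => ->.
have top : #|[set x in E | ~~ up x]| <= n.
  apply: extreme => -[a b] [c d] /= Eab Ecd /existsPn U1 /existsPn U2 eq_bd.
  have := U1 c; have := U2 a; rewrite /= -eq_bd Eab eq_bd Ecd !andbT.
  by case: (ltngtP (a : nat) c) => // /ord_inj.
have bot : #|[set x in E | ~~ dn x]| <= n.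
  apply: extreme => -[a b] [c d] /= Eab Ecd /existsPn U1 /existsPn U2 eq_bd.
  have := U1 c; have := U2 a; rewrite /= -eq_bd Eab eq_bd Ecd !andbT.
  by case: (ltngtP (a : nat) c) => // /ord_inj.
pose A (i : 'I_m) := [set j | [&& (i, j) \in E, up (i, j) & dn (i, j)]].
have leA i : #|A i| <= l.-1.
  rewrite leqNgt; apply/negP=> ltA; apply: nE.
  apply: (@rich_row_folds _ _ _ E i (A i)) => //; first by rewrite -(prednK l_gt0).
  move=> j; rewrite inE => /and3P[Eij /existsP[i0 /andP[? ?]] /existsP[i1 /andP[? ?]]].
  by split=> //; [exists i0 | exists i1].
have A0 (i : 'I_m) : ~~ ((0 < i) && (i.+1 < m)) -> #|A i| = 0.
  move=> Hi; apply: eq_card0 => j; rewrite !inE; apply/negP.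
  case/and3P=> _ /existsP[i0 /andP[/= lt0 _]] /existsP[i1 /andP[/= lt1 _]].
  by case/negP: Hi; have := ltn_ord i1; lia.
have mid : #|[set x in E | up x && dn x]| <= l.-1 * (m - 2).
  have -> : #|[set x in E | up x && dn x]| = \sum_i #|A i|.
    by rewrite card_rows; apply: eq_bigr => i _; apply: eq_card => j; rewrite !inE.
  rewrite (bigID (fun i : 'I_m => (0 < i) && (i.+1 < m))) /=.
  rewrite [X in _ + X]big1 ?addn0 //.
  apply: (@leq_trans (\sum_(i < m | (0 < i) && (i.+1 < m)) l.-1)).
    exact: leq_sum.
  rewrite big_mkcond /= mulnC; case: (m) => [|[|k]]; first by rewrite big_ord0.
    by rewrite big_ord1.
  rewrite big_ord_recl big_ord_recr /= ltnn addn0 add0n subn2 /=.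
  apply: (@leq_trans (\sum_(i < k) l.-1)); last by rewrite sum_nat_const card_ord.
  by apply: leq_sum => i _; case: ifP.
have sub : E \subset [set x in E | up x && dn x] :|:
    ([set x in E | ~~ up x] :|: [set x in E | ~~ dn x]).
  by apply/subsetP=> x Ex; rewrite !inE Ex /=; case: (up x); case: (dn x).
have := subset_leq_card sub; rewrite !cardsU; lia.
Qed.

(** * The band construction for the lower bound *)

(* The disjuncts [x.1 < 2] and [p - 2 <= x.1] set the left end of the first two
   rows to [0] and the right end of the last two rows to [q - 1]. *)
Definition band_edges p q k : {set 'I_p * 'I_q} :=
  [set x : 'I_p * 'I_q | ((x.1 < 2) || (k * ((x.1 - 2) %/ k) <= x.2))
        && ((p - 2 <= x.1) || (x.2 <= k.+1 + k * (x.1 %/ k)))].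

Lemma ltn_ceil_mul k i : 0 < k -> i < k * (i %/ k).+1.
Proof. by move=> k_gt0; rewrite mulnC ltn_ceil. Qed.

(** The quotient [(i - 1) %/ k] gives both the right end of row [i - 1] and the left end of row
    [i + 1], and the ends are monotone in the row. *)
Lemma band_rows p q k (i : nat) : 0 < k -> 0 < i -> i.+1 < p ->
  exists lo, forall x, x \in band_edges p q k ->
    (x.1 < i -> x.2 < lo + k.+3.-1) /\ (i < x.1 -> lo <= x.2).
Proof.
move=> k_gt0 i_gt0 lt_ip; exists (k * (i.-1 %/ k)) => -[a b].
rewrite inE /= => /andP[La Ra]; split=> [lt_ai|lt_ia].
  case/orP: Ra => [|Ra]; first by lia.
  have : k * (a %/ k) <= k * (i.-1 %/ k) by apply/leq_mul/leq_div2r => //; lia.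
  lia.
case/orP: La => [|La]; first by lia.
by rewrite (leq_trans _ La) //; apply/leq_mul/leq_div2r => //; lia.
Qed.

Lemma band_columns p q k (j : nat) : 0 < k -> 0 < j ->
  exists lo, forall x, x \in band_edges p q k ->
    (x.2 < j -> x.1 < lo + k.+3.-1) /\ (j < x.2 -> lo <= x.1).
Proof.
move=> k_gt0 j_gt0; pose c := j.-1 %/ k.
have jlt : j.-1 < k * c.+1 by apply: ltn_ceil_mul.
have jge : k * c <= j.-1 by rewrite mulnC leq_trunc_div.
(* The cap [p - 2] accounts for the last two rows, whose right ends are not bounded by the
   quotient. *)
exists (minn (k * c) (p - 2)) => -[a b].
rewrite inE /= => /andP[La Ra]; split=> [lt_bj|lt_jb].
  case: (leqP (k * c) (p - 2)) => [le_cp|lt_pc]; last by have := ltn_ord a; lia.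
  case/orP: La => [|La]; first by lia.
  have : a - 2 < k * ((a - 2) %/ k).+1 by apply: ltn_ceil_mul.
  have : (a - 2) %/ k <= c.
    by rewrite -ltnS -(ltn_pmul2l k_gt0); lia.
  by rewrite -ltnS -(leq_pmul2l k_gt0) !mulnS; lia.
case/orP: Ra => [|Ra]; first by lia.
have : c <= a %/ k.
  by rewrite -ltnS -(ltn_pmul2l k_gt0) mulnS; lia.
rewrite -(leq_pmul2l k_gt0); have := leq_trunc_div a k; lia.
Qed.

(** The copy with exchanged parts is excluded by the column version of the band condition. *)
Lemma band_minor_free p q k : 0 < k ->
  ~ interval_minor (complete_bipartite 3 k.+3) (OBGraph (band_edges p q k)).
Proof.
move=> k_gt0 /interval_minor_folds[]; apply: band_not_folds => //= i i_gt0 lt_i.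
  exact: band_rows.
have [lo Hlo] := @band_columns p q k i k_gt0 i_gt0; exists lo => -[a b].
by rewrite inE => /Hlo.
Qed.

Lemma card_ord_interval n lo hi : hi < n -> hi.+1 - lo <= #|[set j : 'I_n | lo <= j <= hi]|.
Proof.
move=> lt_hi; have ltb (t : 'I_(hi.+1 - lo)) : lo + t < n by have := ltn_ord t; lia.
rewrite -[leqLHS]card_ord -(card_imset (f := fun t => Ordinal (ltb t))).
  apply/subset_leq_card/subsetP=> _ /imsetP[t _ ->]; rewrite inE /=.
  by have := ltn_ord t; lia.
by move=> t u [] /addnI/val_inj.
Qed.

(** Pairing the right end of row [i] with the left end of row [i + 2] cancels the quotients: [p - 2]
    pairs give [k + 2] each, and the last two right ends give [2 * q]. *)
Lemma card_band p q k : 0 < k -> 1 < p ->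
    k.+1 + k * ((p - 3) %/ k) < q ->
  k.+2 * (p - 2) + 2 * q <= #|band_edges p q k|.
Proof.
move=> k_gt0 p_gt1 lt_q.
pose L i := if i < 2 then 0 else k * ((i - 2) %/ k).
(* [R i] is one past the last column of row [i]. *)
pose R i := if p - 2 <= i then q else k.+2 + k * (i %/ k).
have Rq i : R i <= q.
  rewrite /R; case: ifPn => //; rewrite -ltnNge => lt_ip.
  have : k * (i %/ k) <= k * ((p - 3) %/ k) by apply/leq_mul/leq_div2r => //; lia.
  lia.
rewrite card_rows.
apply: (@leq_trans (\sum_(i < p) (R i - L i))); last first.
  apply: leq_sum => i _.
  case: (posnP (R i)) => [->|R_gt0]; first by rewrite sub0n.
  rewrite -(prednK R_gt0); apply: leq_trans (card_ord_interval _ _) _.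
    by rewrite prednK.
  apply/subset_leq_card/subsetP=> j; rewrite !inE /= => /andP[lej jle].
  have {jle} : j < R i by lia.
  by move: lej; rewrite /L /R; case: (i < 2) => /= [_|->]; case: (p - 2 <= i).
rewrite -(leq_add2r (\sum_(i < p) L i)) -big_split /=.
apply: (@leq_trans (\sum_(i < p) R i)); last by apply: leq_sum => i _; lia.
rewrite -!(big_mkord xpredT) -(subnK p_gt1) addn2.
rewrite [X in _ + X]big_nat_recl // [X in _ + (_ + X)]big_nat_recl //=.
rewrite [X in _ <= X]big_nat_recr // [X in _ <= X + _]big_nat_recr //=.
set m := p - 2.
have -> : \sum_(0 <= i < m) L i.+2 = \sum_(0 <= i < m) k * (i %/ k).
  by apply: eq_bigr => i _; rewrite /L /= subn2.
have -> : \sum_(0 <= i < m) R i = \sum_(0 <= i < m) (k.+2 + k * (i %/ k)).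
  by apply: eq_big_nat => i /andP[_ lt_im]; rewrite /R leqNgt lt_im.
rewrite big_split /= sum_nat_const_nat /L /R /= leqnn leqnSn subn0; lia.
Qed.

Theorem theorem4p3 (l p q r s e f : nat)
    (hl : 4 <= l)
    (he : 2 <= e <= l - 2) (hf : 2 <= f <= l - 2)
    (hp : p = (l - 3) * r + e) (hq : q = (l - 3) * s + f)
    (hrs : r < s) :
  ex_interval p q (complete_bipartite 3 l) = (l - 1) * (p - 2) + 2 * q.
Proof.
have [k Dl] : exists k, l = k.+3 by exists (l - 3); lia.
have k_gt0 : 0 < k by lia.
apply/eqP; rewrite eqn_leq /ex_interval; apply/andP; split.
  apply/bigmax_leqP=> E /asboolP nE; rewrite subn1; apply: card_not_folds; first by lia.
  by move/(folds_complete_minor (a := 3)) => H; apply/nE/H; lia.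
have nE := @band_minor_free p q k k_gt0; rewrite -Dl in nE.
apply: leq_trans (leq_bigmax_cond (band_edges p q k) _); last exact/asboolP.
rewrite (_ : l - 1 = k.+2); last by lia.
have Dk : l - 3 = k by lia.
rewrite Dk in hp hq.
(* Since [(p - 3) %/ k <= r], the widest row below the cap ends by column [k * r.+1 + 1], which is
   less than [k * s + f] because [f >= 2]. *)
have le_rs : k * r.+1 <= k * s by rewrite leq_mul2l hrs orbT.
apply: card_band => //; try lia.
have : (p - 3) %/ k <= r.
  rewrite -ltnS ltn_divLR //; lia.
rewrite -(leq_pmul2l k_gt0); lia.
Qed.
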